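(* Let $\lambda\in\mathbb{R}$, let $n,r\in\mathbb{N}$ (positive integers) with $n\ge r$, and let $k_1,\dots,k_r\in\mathbb{Z}$. Then $$g_{n,\lambda}^{(k_1,\dots,k_r)}(x)=\sum_{l=0}^{n-r}\binom{n}{l}\mathcal{E}^{(r)}_{l,\lambda}(x)\sum_{0<n_1<n_2<\cdots<n_r\le n-l}\frac{(1)_{n_1,\lambda}\cdots(1)_{n_r,\lambda}\,S_{1,\lambda}(n-l,n_r)}{(n_1-1)!\cdots(n_{r-1}-1)!\;n_1^{k_1}\cdots n_{r-1}^{k_{r-1}}\,n_r^{k_r-1}},$$ where the inner sum is over all integers $n_1,\dots,n_r$ satisfying the indicated inequalities. Further, $g_{n,\lambda}^{(k_1,\dots,k_r)}(x)=0$ for $0\le n\le r-1$.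
   Context: All generating functions are formal power series in $t$; $x$ is a real variable (or indeterminate). Degenerate falling factorials: $(x)_{0,\lambda}=1$, $(x)_{n,\lambda}=x(x-\lambda)\cdots(x-(n-1)\lambda)$ for $n\ge1$. Ordinary falling factorials: $(x)_0=1$, $(x)_n=x(x-1)\cdots(x-n+1)$ for $n\ge 1$. Degenerate exponentials: $e_\lambda^x(t)=(1+\lambda t)^{x/\lambda}=\sum_{n\ge0}(x)_{n,\lambda}\frac{t^n}{n!}$ and $e_\lambda(t)=e_\lambda^1(t)$. Degenerate logarithm: $\log_\lambda(t)=\frac1\lambda(t^\lambda-1)$, the compositional inverse of $e_\lambda(t)$; thus $\log_\lambda(1+t)=\frac{(1+t)^\lambda-1}{\lambda}$. For $\lambda=0$ these are read as their limits $e^{xt}$, $e^t$ and $\log t$. Degenerate Stirling numbers of the first kind $S_{1,\lambda}(n,l)$: defined by $(x)_n=\sum_{l=0}^nS_{1,\lambda}(n,l)(x)_{l,\lambda}$ for $n\ge0$. Degenerate Euler polynomials of order $r$: $\left(\frac{2}{e_\lambda(t)+1}\right)^re_\lambda^x(t)=\sum_{n\ge0}\mathcal{E}^{(r)}_{n,\lambda}(x)\frac{t^n}{n!}$. Degenerate multiple polyexponential function: for $k_1,\dots,k_r\in\mathbb{Z}$, $$Ei_{k_1,\dots,k_r,\lambda}(x)=\sum_{0<n_1<n_2<\cdots<n_r}\frac{(1)_{n_1,\lambda}\cdots(1)_{n_r,\lambda}\,x^{n_r}}{(n_1-1)!(n_2-1)!\cdots(n_r-1)!\,n_1^{k_1}\cdots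 n_r^{k_r}},$$ the sum being over all integers $n_1,\dots,n_r$ with $0<n_1<\cdots<n_r$. Degenerate multi-poly-Genocchi polynomials $g_{n,\lambda}^{(k_1,\dots,k_r)}(x)$: defined by $$\frac{2^r\,Ei_{k_1,\dots,k_r,\lambda}(\log_\lambda(1+t))}{(e_\lambda(t)+1)^r}\,e_\lambda^x(t)=\sum_{n=0}^\infty g_{n,\lambda}^{(k_1,\dots,k_r)}(x)\frac{t^n}{n!}.$$ Empty products equal $1$. *)

(* Defs.v *)
From HB Require Import structures.
From mathcomp Require Import all_boot all_order all_algebra.
From mathcomp Require Import boolp reals.
From mathcomp Require Import ring.

Set Implicit Arguments.
Unset Strict Implicit.
Unset Printing Implicit Defensive.

Import Order.TTheory GRing.Theory Num.Theory.
Local Open Scope ring_scope.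

(* Formal power series in one variable t over a field F: the n-th component is
   the (ordinary, not exponential) coefficient of t ^+ n. *)
Record fps (F : fieldType) := Fps { fcoef : nat -> F }.

Coercion fcoef : fps >-> Funclass.

Notation "\fps_ n E" := (Fps (fun n : nat => E))
  (at level 36, n name, E at level 36, format "\fps_ n  E") : ring_scope.

Section FpsRing.
Variable F : fieldType.
Implicit Types (f g h : fps F).

Lemma fpsP f g : (forall n, f n = g n) -> f = g.
Proof. by case: f g => [f] [g] /= fg; congr Fps; apply/funext. Qed.

HB.instance Definition _ := gen_eqMixin (fps F).
HB.instance Definition _ := gen_choiceMixin (fps F).

Definition fps_zero : fps F := \fps_n 0.
Definition fps_opp f : fps F := \fps_n (- f n).
Definition fps_add f g : fps F := \fps_n (f n + g n).

Fact fps_addA : associative fps_add.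
Proof. by move=> f g h; apply: fpsP => n /=; rewrite addrA. Qed.
Fact fps_addC : commutative fps_add.
Proof. by move=> f g; apply: fpsP => n /=; rewrite addrC. Qed.
Fact fps_add0 : left_id fps_zero fps_add.
Proof. by move=> f; apply: fpsP => n /=; rewrite add0r. Qed.
Fact fps_addN : left_inverse fps_zero fps_opp fps_add.
Proof. by move=> f; apply: fpsP => n /=; rewrite addNr. Qed.

HB.instance Definition _ :=
  GRing.isZmodule.Build (fps F) fps_addA fps_addC fps_add0 fps_addN.

Definition fps_one : fps F := \fps_n (n == 0%N)%:R.
Definition fps_mul f g : fps F :=
  \fps_n (\sum_(i < n.+1) f i * g (n - i)%N).

Let tr n f : {poly F} := \poly_(i < n.+1) f i.

Let tr_mul n m f g : (m <= n)%N -> (fps_mul f g) m = (tr n f * tr n g)`_m.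
Proof.
move=> lemn; rewrite coefM /=; apply: eq_bigr => i _.
have lein : (i < n.+1)%N by rewrite (leq_trans (ltn_ord i)).
have leimn : (m - i < n.+1)%N by rewrite ltnS (leq_trans (leq_subr _ _)).
by rewrite !coef_poly lein leimn.
Qed.

Fact fps_mulC : commutative fps_mul.
Proof. by move=> f g; apply: fpsP => n; rewrite !(@tr_mul n n) // mulrC. Qed.

Let tr_mul_mul n f g h :
  (fps_mul (fps_mul f g) h) n = (tr n f * tr n g * tr n h)`_n.
Proof.
rewrite coefM.
transitivity (\sum_(i < n.+1) fps_mul f g i * h (n - i)%N) => //.
apply: eq_bigr => i _; have lein : (i <= n)%N by rewrite -ltnS.
by rewrite (@tr_mul n i) // coef_poly ltnS leq_subr.
Qed.

Fact fps_mulA : associative fps_mul.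
Proof.
move=> f g h; apply: fpsP => n; rewrite fps_mulC !tr_mul_mul.
by rewrite mulrC mulrA.
Qed.

Fact fps_mul1 : left_id fps_one fps_mul.
Proof.
move=> f; apply: fpsP => n /=; rewrite big_ord_recl /= subn0 mul1r big1 ?addr0//.
by move=> i _; rewrite mul0r.
Qed.

Fact fps_mulD : left_distributive fps_mul +%R.
Proof.
move=> f g h; apply: fpsP => n /=; rewrite -big_split /=.
by apply: eq_bigr => i _; rewrite mulrDl.
Qed.

Fact fps_one_neq0 : fps_one != 0.
Proof.
apply/eqP => /(congr1 (fun f : fps F => f 0%N)) /= /eqP.
by rewrite oner_eq0.
Qed.

HB.instance Definition _ := GRing.Zmodule_isComNzRing.Build (fps F)
  fps_mulA fps_mulC fps_mul1 fps_mulD fps_one_neq0.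

Definition fps_scale (a : F) f : fps F := \fps_n (a * f n).

Fact fps_scaleA a b f :
  fps_scale a (fps_scale b f) = fps_scale (a * b) f.
Proof. by apply: fpsP => n /=; rewrite mulrA. Qed.
Fact fps_scale1 : left_id 1 fps_scale.
Proof. by move=> f; apply: fpsP => n /=; rewrite mul1r. Qed.
Fact fps_scaleDr : right_distributive fps_scale +%R.
Proof. by move=> a f g; apply: fpsP => n /=; rewrite mulrDr. Qed.
Fact fps_scaleDl f : {morph fps_scale^~ f : a b / a + b}.
Proof. by move=> a b; apply: fpsP => n /=; rewrite mulrDl. Qed.

HB.instance Definition _ := GRing.Zmodule_isLmodule.Build F (fps F)
  fps_scaleA fps_scale1 fps_scaleDr fps_scaleDl.

(* First n.+1 coefficients of the inverse of f, when f has a nonzero constant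
   coefficient. *)
Fixpoint fps_inv_seq f (n : nat) : seq F :=
  if n is n'.+1 then
    let s := fps_inv_seq f n' in
    rcons s (- (f 0%N)^-1 * \sum_(i < n'.+1) f i.+1 * s`_(n' - i)%N)
  else [:: (f 0%N)^-1].

Definition fps_unit : {pred fps F} := fun f => f 0%N != 0.
Definition fps_inv f : fps F :=
  if f 0%N == 0 then f else \fps_n (fps_inv_seq f n)`_n.

Let size_inv_seq f n : size (fps_inv_seq f n) = n.+1.
Proof. by elim: n => //= n IHn; rewrite size_rcons IHn. Qed.

Let nth_inv_seq f n m : (m <= n)%N ->
  (fps_inv_seq f n)`_m = (fps_inv_seq f m)`_m.
Proof.
elim: n => [|n IHn]; first by rewrite leqn0 => /eqP->.
rewrite leq_eqVlt => /predU1P[->//|ltmn].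
by rewrite /= nth_rcons size_inv_seq ltmn IHn.
Qed.

Fact fps_mulVf : {in fps_unit, left_inverse 1 fps_inv *%R}.
Proof.
move=> f f0; have {}f0 : f 0%N != 0 by [].
rewrite /fps_inv (negPf f0) mulrC; apply: fpsP => -[|n] /=.
  by rewrite big_ord_recl big_ord0 /= addr0 mulfV.
rewrite big_ord_recl /= nth_rcons size_inv_seq ltnn eqxx mulrA mulrN.
rewrite mulfV // mulN1r; apply/eqP; rewrite addrC subr_eq0; apply/eqP.
apply: eq_bigr => i _; rewrite /bump /= add1n subSS.
by rewrite (@nth_inv_seq f n (n - i)) // leq_subr.
Qed.

Fact fps_unitP f g : g * f = 1 -> fps_unit f.
Proof.
move=> /(congr1 (fun f : fps F => f 0%N)) /=.
rewrite big_ord_recl big_ord0 /= addr0 => gf1; apply/eqP => f0.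
by move/eqP: gf1; rewrite f0 mulr0 eq_sym oner_eq0.
Qed.

Fact fps_inv_out : {in [predC fps_unit], fps_inv =1 id}.
Proof. by move=> f /negPn f0; rewrite /fps_inv f0. Qed.

HB.instance Definition _ := GRing.ComNzRing_hasMulInverse.Build (fps F)
  fps_mulVf fps_unitP fps_inv_out.

(* f (g (t)), meaningful only when g has zero constant coefficient: then
   g ^+ m does not contribute to the coefficient of t ^+ n for n < m. *)
Definition fps_comp f g : fps F :=
  \fps_n (\sum_(m < n.+1) f m * (g ^+ m) n).

End FpsRing.

Notation "f \oF g" := (fps_comp f g) (at level 50) : ring_scope.

Section Degenerate.
Variable R : realType.
Implicit Types (lam x : R).

Definition ffall x (n : nat) : R := \prod_(i < n) (x - i%:R).

Definition dfall lam x (n : nat) : R := \prod_(i < n) (x - i%:R * lam).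

(* (1 + lam t) `^ (x / lam); for lam = 0 this is exp (x t). *)
Definition dexp lam x : fps R := \fps_n (dfall lam x n / n`!%:R).

(* (1 + t) `^ a, by the binomial series. *)
Definition binomial_series (a : R) : fps R := \fps_n (ffall a n / n`!%:R).

(* log_lam (1 + t), which is log (1 + t) for lam = 0; beware that division by
   zero makes 0^-1 = 0 and the limit case has to be given separately. *)
Definition dlog1p lam : fps R :=
  if lam == 0 then \fps_n (if n is m.+1 then (-1) ^+ m / m.+1%:R else 0)
  else lam^-1 *: (binomial_series lam - 1).

Lemma dlog1p_coef0 lam : (dlog1p lam) 0%N = 0.
Proof.
rewrite /dlog1p; case: ifP => //= _.
by rewrite /ffall big_ord0 fact0 divr1 subrr mulr0.
Qed.

Lemma dexpD1_unit lam : dexp lam 1 + 1 \is a GRing.unit.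
Proof.
change (dfall lam 1 0 / 0`!%:R + 1 != 0 :> R).
by rewrite /dfall big_ord0 fact0 divr1 -(natrD _ 1 1) pnatr_eq0.
Qed.

Lemma stirling1_exists lam : exists S : nat -> nat -> R, forall n x,
  ffall x n = \sum_(l < n.+1) S n l * dfall lam x l.
Proof.
pose fix S (n l : nat) {struct n} : R := match n, l with
  | 0%N, 0%N => 1
  | 0%N, _.+1 => 0
  | n'.+1, 0%N => - n'%:R * S n' 0%N
  | n'.+1, l'.+1 => S n' l' + (l'.+1%:R * lam - n'%:R) * S n' l'.+1
  end.
have S0 n : forall l, (n < l)%N -> S n l = 0.
  elim: n => [[]//|n IHn [//|l]]; rewrite ltnS => ltnl /=.
  by rewrite !IHn ?mulr0 ?addr0 // (ltn_trans ltnl).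
exists S => n x; elim: n => [|n IHn].
  by rewrite big_ord_recl big_ord0 /ffall /dfall !big_ord0 mulr1 addr0.
rewrite /ffall big_ord_recr /= -/(ffall x n) IHn mulr_suml.
have E (l : nat) : S n l * dfall lam x l * (x - n%:R) =
    S n l * dfall lam x l.+1 + (l%:R * lam - n%:R) * S n l * dfall lam x l.
  by rewrite /dfall big_ord_recr /=; ring.
under [LHS]eq_bigr => l _ do rewrite E.
rewrite big_split /= addrC big_ord_recl [RHS]big_ord_recl /= mul0r sub0r.
rewrite -addrA; congr (_ + _).
under [RHS]eq_bigr => l _ do rewrite mulrDl.
rewrite big_split /= addrC; congr (_ + _).
by rewrite [RHS]big_ord_recr /= S0 // mulr0 mul0r addr0.
Qed.

(* Only the values with l <= n are determined (uniquely, see below). *)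
Definition stirling1 lam : nat -> nat -> R := sval (cid (stirling1_exists lam)).

Lemma stirling1P lam n x :
  ffall x n = \sum_(l < n.+1) stirling1 lam n l * dfall lam x l.
Proof. by rewrite /stirling1; case: cid. Qed.

Lemma dfall_free lam (n : nat) (c : nat -> R) :
  (forall x, \sum_(l < n) c l * dfall lam x l = 0) ->
  forall l, (l < n)%N -> c l = 0.
Proof.
pose P l : {poly R} := \prod_(i < l) ('X - (i%:R * lam)%:P).
have PE x l : (P l).[x] = dfall lam x l.
  by rewrite horner_prod; apply: eq_bigr => i _; rewrite hornerXsubC.
have sP l : size (P l) = l.+1.
  by rewrite size_prod_XsubC [index_enum _]unlock /= -enumT size_enum_ord.
have mP l : (P l)`_l = 1.
  have /monicP : P l \is monic by apply: monic_prod_XsubC.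
  by rewrite /lead_coef sP.
elim: n => [//|n IHn] c0 l.
pose q := \sum_(l < n.+1) c l *: P l.
have q0 : q = 0.
  apply: (@roots_geq_poly_eq0 _ _ [seq i%:R | i <- iota 0 (size q)]).
  - apply/allP => x _; apply/rootP; rewrite horner_sum -[RHS](c0 x).
    by apply: eq_bigr => i _; rewrite hornerZ PE.
  - by rewrite map_inj_uniq ?iota_uniq // => i j /eqP; rewrite eqr_nat => /eqP.
  - by rewrite size_map size_iota.
have cn : c n = 0.
  have := congr1 (fun p : {poly R} => p`_n) q0.
  rewrite coef0 coef_sum big_ord_recr /= coefZ mP mulr1 big1 ?add0r // => i _.
  by rewrite coefZ nth_default ?mulr0 // sP.
rewrite ltnS leq_eqVlt => /predU1P[->//|]; apply: IHn => x.
by rewrite -[RHS](c0 x) big_ord_recr /= cn mul0r addr0.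
Qed.

Lemma stirling1_unique lam (S : nat -> nat -> R) :
  (forall n x, ffall x n = \sum_(l < n.+1) S n l * dfall lam x l) ->
  forall n l, (l <= n)%N -> S n l = stirling1 lam n l.
Proof.
move=> HS n l leln; apply/eqP; rewrite -subr_eq0; apply/eqP.
apply: (@dfall_free lam n.+1 (fun l => S n l - stirling1 lam n l)) => // x.
under eq_bigr => i _ do rewrite mulrBl.
by rewrite sumrB -HS -stirling1P subrr.
Qed.

(* \cE^(r)_{n,lam}(x) *)
Definition dEuler lam (r n : nat) x : R :=
  n`!%:R * ((2%:R / (dexp lam 1 + 1)) ^+ r * dexp lam x) n.

Definition chain r (m : 'I_r.+1 -> nat) : bool :=
  (0 < m ord0)%N &&
  [forall i : 'I_r.+1, forall j : 'I_r.+1, (i < j)%N ==> (m i < m j)%N].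

(* The r.+1 indices k_1, ..., k_(r.+1) of the paper are k 0, ..., k r here;
   since the outer variable occurs with exponent m ord_max, the coefficient of
   degree N collects the (finitely many) chains ending in N. *)
Definition dEi lam r (k : 'I_r.+1 -> int) : fps R :=
  \fps_N (\sum_(m : {ffun 'I_r.+1 -> 'I_N.+1}
                 | chain (fun i => m i) && (m ord_max == N :> nat))
     (\prod_i dfall lam 1 (m i)) /
     ((\prod_i (m i).-1`!%:R) * \prod_i (m i)%:R ^ k i)).

(* g_{n,lam}^{(k_1, ..., k_(r.+1))}(x) *)
Definition dmpGenocchi lam r (k : 'I_r.+1 -> int) (n : nat) x : R :=
  n`!%:R * (2%:R ^+ r.+1 * (dEi lam k \oF dlog1p lam)
              / (dexp lam 1 + 1) ^+ r.+1 * dexp lam x) n.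

End Degenerate.

(* Main.v *)
Require Import Defs.
From mathcomp Require Import all_boot all_order all_algebra.
From mathcomp Require Import boolp reals.
From mathcomp Require Import ring.

Set Implicit Arguments.
Unset Strict Implicit.
Unset Printing Implicit Defensive.

Import GRing.Theory Num.Theory.

Local Open Scope ring_scope.

(** Write [L = log_lam (1 + t)]. The generating function of the Genocchi
    polynomials is the product of that of the Euler polynomials of order [r]
    with [Ei o L], so everything reduces to the coefficients of [Ei o L], that
    is, to those of the powers of [L]. These are given by
      [L ^+ l / l! = \sum_n S_1(n, l) t ^+ n / n!]   ([coef_dlog1pX]).
    To see this, note that [(1 + t) L' = 1 + lam L] for every [lam], zero
    included ([dlog1p_ode]). Hence the numbers [n! / l! [t ^+ n] L ^+ l] satisfy
    a two-term recurrence ([log_coefSS]), from which it follows by induction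
    that they expand falling factorials in degenerate falling factorials; the
    coefficients of such an expansion are unique.

    In [Ei o L], a chain [n_1 < ... < n_r] contributes through [L ^+ n_r]; the
    factor [n_r!] coming from this power cancels [(n_r - 1)!] up to [n_r], which
    turns the exponent [k_r] into [k_r - 1] ([coef_dEi_dlog1p]). The binomial
    convolution with the Euler polynomials gives a sum over all [l <= n]
    ([dmpGenocchi_sum]). A chain of [r] positive integers ends in at least [r],
    so the terms with [n - l < r] vanish: this truncates the sum when [n >= r]
    and annihilates it when [n < r]. *)

(** * Coefficients of power series and the Euler operator *)

Section FpsCoefficients.
Variable F : fieldType.
Implicit Types (f g : fps F) (a : F) (n m : nat).

Lemma fcoefD f g n : (f + g) n = f n + g n. Proof. by []. Qed.

Lemma fcoefZ a f n : (a *: f) n = a * f n. Proof. by []. Qed.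

Lemma fcoef1 n : (1 : fps F) n = (n == 0%N)%:R. Proof. by []. Qed.

Lemma fcoefM f g n : (f * g) n = \sum_(i < n.+1) f i * g (n - i)%N.
Proof. by []. Qed.

Lemma fcoefMn f m n : (f *+ m) n = f n *+ m.
Proof. by elim: m => [//|m IHm]; rewrite !mulrS fcoefD IHm. Qed.

Lemma fcoefX0 f m : (f ^+ m) 0%N = f 0%N ^+ m.
Proof.
elim: m => [//|m IHm].
by rewrite !exprS fcoefM big_ord_recl big_ord0 addr0 subn0 IHm.
Qed.

Lemma fps_scaleAr a f g : f * (a *: g) = a *: (f * g).
Proof.
apply: fpsP => n; rewrite fcoefZ !fcoefM mulr_sumr.
by apply: eq_bigr => i _; rewrite fcoefZ mulrCA.
Qed.

Definition fpsX : fps F := \fps_n (n == 1%N)%:R.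

Lemma fcoefXM f n : (fpsX * f) n.+1 = f n.
Proof.
rewrite fcoefM big_ord_recl mul0r add0r big_ord_recl mul1r subSS subn0.
by rewrite big1 ?addr0 // => i _; rewrite mul0r.
Qed.

(** The Euler operator [t d/dt]: unlike [d/dt] it does not shift degrees, so
    its Leibniz rule is a termwise identity. *)
Definition euler_op f : fps F := \fps_n (f n *+ n).

Lemma euler_opM f g : euler_op (f * g) = euler_op f * g + f * euler_op g.
Proof.
apply: fpsP => n; rewrite fcoefD !fcoefM /= -sumrMnl -big_split /=.
apply: eq_bigr => i _; rewrite mulrnAl mulrnAr -mulrnDr subnKC //.
by rewrite -ltnS.
Qed.

Lemma euler_opXn f m : euler_op (f ^+ m) = (f ^+ m.-1 * euler_op f) *+ m.
Proof.
elim: m => [|[|m] IHm].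
- by apply: fpsP => -[|n]; rewrite /= ?mul0rn.
- by rewrite mul1r.
- rewrite exprS euler_opM IHm /= mulrnAr mulrA -exprS.
  by rewrite [RHS]mulrS [euler_op f * _]mulrC.
Qed.

End FpsCoefficients.

(** * Powers of the degenerate logarithm and Stirling numbers *)

Section StirlingLog.
Variable R : realType.
Implicit Types (lam : R).

(** The differential equation [(1 + t) L' = 1 + lam L], multiplied by
    [t], of [L = log_lam (1 + t)]; it has the same shape for [lam = 0], so that
    the two cases in the definition of [L] are treated alike from here on. *)
Lemma dlog1p_ode lam :
  (1 + fpsX R) * euler_op (dlog1p lam) = fpsX R * (1 + lam *: dlog1p lam).
Proof.
apply: fpsP => -[|n].
  by rewrite !fcoefM !big_ord_recl !big_ord0 /= mulr0n mulr0 mul0r.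
rewrite fcoefXM mulrDl mul1r fcoefD fcoefXM fcoefD fcoefZ fcoef1.
rewrite /euler_op /dlog1p /=; case: eqVneq => [->|lam0].
  rewrite mul0r addr0 -[(_ / _) *+ _]mulr_natr mulfVK ?pnatr_eq0 //.
  case: n => [|n]; first by rewrite mul0rn addr0.
  by rewrite -[(_ / _) *+ _]mulr_natr mulfVK ?pnatr_eq0 // exprS mulN1r addNr.
have n1 : n.+1%:R != 0 :> R by rewrite pnatr_eq0.
have nf : n`!%:R != 0 :> R by rewrite pnatr_eq0 -lt0n fact_gt0.
rewrite /= oppr0 addr0 mulrA divff // mul1r.
have -> : ffall lam n.+1 = ffall lam n * (lam - n%:R).
  by rewrite /ffall big_ord_recr.
case: n n1 nf => [|n] n1 nf /=.
  rewrite /ffall big_ord0 fact0 mulr0n addr0 subr0 mul1r.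
  by rewrite divr1 mulVf // divr1 subrr addr0.
rewrite !subr0 add0r -[lam^-1 * _ *+ n.+2]mulr_natr.
rewrite -[lam^-1 * _ *+ n.+1]mulr_natr factS natrM.
(* The casts are generalized because [field] would expand [n.+2%:R]. *)
move: n1 nf; move: (n.+2%:R : R) ((n.+1)`!%:R : R) (n.+1%:R : R) => a b c a0 b0.
by field; rewrite lam0 b0 a0.
Qed.

(** Rescaled so that these numbers are, as [coef_dlog1pX] shows for [l <= n],
    exactly the degenerate Stirling numbers of the first kind. *)
Definition log_coef lam (n l : nat) : R :=
  n`!%:R / l`!%:R * (dlog1p lam ^+ l) n.

Lemma log_coef00 lam : log_coef lam 0 0 = 1.
Proof. by rewrite /log_coef fact0 divr1 mulr1. Qed.

Lemma log_coef0S lam l : log_coef lam 0 l.+1 = 0.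
Proof. by rewrite /log_coef fcoefX0 dlog1p_coef0 expr0n mulr0. Qed.

Lemma log_coefS0 lam n : log_coef lam n.+1 0 = 0.
Proof. by rewrite /log_coef expr0 fcoef1 mulr0. Qed.

(** Differentiate [L ^+ l.+1] and use the differential equation of [L]:
    [(1 + t) (L ^+ l.+1)' = (l + 1) (L ^+ l + lam L ^+ l.+1)]. *)
Lemma log_coefSS lam n l :
  log_coef lam n.+1 l.+1 =
  log_coef lam n l + (l.+1%:R * lam - n%:R) * log_coef lam n l.+1.
Proof.
have ode : (1 + fpsX R) * euler_op (dlog1p lam ^+ l.+1) =
    fpsX R * (dlog1p lam ^+ l + lam *: dlog1p lam ^+ l.+1) *+ l.+1.
  rewrite euler_opXn /= mulrnAr mulrCA dlog1p_ode mulrCA mulrDr mulr1.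
  by rewrite fps_scaleAr -exprSr.
have /(congr1 (fun f : fps R => f n.+1)) := ode.
rewrite mulrDl mul1r fcoefMn fcoefD !fcoefXM fcoefD fcoefZ /=.
rewrite /log_coef; move: (dlog1p lam ^+ l) (dlog1p lam ^+ l.+1) => f g.
rewrite -[g _ *+ n.+1]mulr_natr -[g n *+ n]mulr_natr.
rewrite -[_ *+ l.+1]mulr_natr => E.
have {E} -> : g n.+1 = ((f n + lam * g n) * l.+1%:R - g n * n%:R) / n.+1%:R.
  by rewrite -E addrK mulfK // pnatr_eq0.
have n1 : n.+1%:R != 0 :> R by rewrite pnatr_eq0.
have l1 : l.+1%:R != 0 :> R by rewrite pnatr_eq0.
have lf : l`!%:R != 0 :> R by rewrite pnatr_eq0 -lt0n fact_gt0.
rewrite !factS !natrM; move: n1 l1 lf.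
move: (n.+1%:R : R) (l.+1%:R : R) (l`!%:R : R) => a b c a0 b0 c0.
by field; rewrite a0 b0 c0.
Qed.

Lemma log_coef_gt lam n l : (n < l)%N -> log_coef lam n l = 0.
Proof.
elim: n l => [|n IHn] [|l] // ltnl; first exact: log_coef0S.
by rewrite log_coefSS !IHn ?mulr0 ?addr0 // ltnW.
Qed.

(** Coefficientwise form of [(1 + t) `^ x = e_lam^x (log_lam (1 + t))]. The
    step from [n] to [n.+1] multiplies by
    [x - n = (x - l lam) + (l lam - n)]. *)
Lemma ffall_log_coef lam n x :
  ffall x n = \sum_(l < n.+1) log_coef lam n l * dfall lam x l.
Proof.
elim: n => [|n IHn].
  by rewrite big_ord1 log_coef00 /ffall /dfall !big_ord0 mulr1.
rewrite {1}/ffall big_ord_recr /= -/(ffall x n) IHn mulr_suml.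
have E (l : nat) : log_coef lam n l * dfall lam x l * (x - n%:R) =
    log_coef lam n l * dfall lam x l.+1
    + (l%:R * lam - n%:R) * log_coef lam n l * dfall lam x l.
  by rewrite /dfall big_ord_recr /=; ring.
under [LHS]eq_bigr => l _ do rewrite E.
rewrite big_split [RHS]big_ord_recl log_coefS0 mul0r add0r /=.
under [RHS]eq_bigr => l _ do rewrite log_coefSS mulrDl.
rewrite big_split /=; congr (_ + _).
(* The right sum is the left one shifted by one index: the first term on the
   left and the last one on the right, the only unmatched ones, vanish. *)
rewrite big_ord_recl [RHS]big_ord_recr /= (log_coef_gt lam (ltnSn n)).
rewrite mulr0 !mul0r addr0 sub0r [X in X + _](_ : _ = 0) ?add0r //.
by case: n {IHn E} => [|n]; rewrite ?log_coefS0 ?mulr0 ?oppr0 !mul0r.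
Qed.

(** Two expansions of the same falling factorial in the degenerate ones have
    the same coefficients. *)
Lemma coef_dlog1pX lam n l : (l <= n)%N ->
  (dlog1p lam ^+ l) n = l`!%:R / n`!%:R * stirling1 lam n l.
Proof.
move=> leln; rewrite -(stirling1_unique (@ffall_log_coef lam)) // /log_coef.
have nf m : m`!%:R != 0 :> R by rewrite pnatr_eq0 -lt0n fact_gt0.
by rewrite mulrA mulrA mulfVK // mulfV // mul1r.
Qed.

End StirlingLog.

(** * Chains of positive integers *)

Section Chains.
Variable r : nat.

Lemma chain_gt0 (m : 'I_r.+1 -> nat) i : chain m -> (0 < m i)%N.
Proof.
case/andP=> m0 /forallP/(_ ord0)/forallP/(_ i)/implyP.
have [-> // | i0 /(_ _)/(leq_ltn_trans _)->//] := eqVneq i ord0.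
by rewrite lt0n.
Qed.

Lemma chain_le_last (m : 'I_r.+1 -> nat) i : chain m -> (m i <= m ord_max)%N.
Proof.
case/andP=> _ /forallP/(_ i)/forallP/(_ ord_max)/implyP.
have [-> // | im /(_ _)/ltnW->//] := eqVneq i ord_max.
by rewrite ltn_neqAle -ltnS ltn_ord andbT.
Qed.

Lemma chain_last_gt (m : 'I_r.+1 -> nat) : chain m -> (r < m ord_max)%N.
Proof.
move=> cm; suff lt_m j (jr : (j < r.+1)%N) : (j < m (Ordinal jr))%N.
  exact: (lt_m r (ltnSn r)).
elim: j jr => [|j IHj] jr; first exact: chain_gt0.
apply: leq_ltn_trans (IHj (ltnW jr)) _.
case/andP: cm => _ /forallP/(_ (Ordinal (ltnW jr)))/forallP/(_ (Ordinal jr)).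
by move/implyP; apply.
Qed.

(** The entries of a chain do not exceed the last one, so a chain ending in
    [M] may be read as taking its values in any ['I_N.+1] with [M <= N]. *)
Lemma sum_chain_last (V : nmodType) (G : ('I_r.+1 -> nat) -> V) M N :
  (M <= N)%N ->
  \sum_(m : {ffun 'I_r.+1 -> 'I_M.+1}
        | chain (fun i => m i) && (m ord_max == M :> nat)) G (fun i => m i) =
  \sum_(m : {ffun 'I_r.+1 -> 'I_N.+1}
        | chain (fun i => m i) && (m ord_max == M :> nat)) G (fun i => m i).
Proof.
move=> leMN; have leMN1 : (M.+1 <= N.+1)%N by [].
pose h (m : {ffun 'I_r.+1 -> 'I_M.+1}) : {ffun 'I_r.+1 -> 'I_N.+1} :=
  [ffun i => widen_ord leMN1 (m i)].
pose h' (m : {ffun 'I_r.+1 -> 'I_N.+1}) : {ffun 'I_r.+1 -> 'I_M.+1} :=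
  [ffun i => inord (m i)].
have hE m : (fun i => h m i : nat) = (fun i => m i : nat).
  by apply: funext => i; rewrite ffunE.
rewrite [RHS](reindex_onto h h') => [|m /andP[cm /eqP mM]].
  apply: eq_big => [m|m _]; last by rewrite hE.
  rewrite hE ffunE /=; suff -> : h' (h m) = m by rewrite eqxx andbT.
  by apply/ffunP => i; rewrite !ffunE; apply: val_inj; rewrite /= inordK.
apply/ffunP => i; rewrite !ffunE; apply: val_inj; rewrite /= inordK // ltnS.
by rewrite -mM; apply: (chain_le_last _ cm).
Qed.

End Chains.

(** * Coefficients of the generating function *)

Section Genocchi.
Variables (R : realType) (lam : R) (r : nat) (k : 'I_r.+1 -> int).

(** The coefficient of [t ^+ N / N!] in [Ei o L], by [coef_dEi_dlog1p]. *)
Definition chain_stirling_sum (N : nat) : R :=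
  \sum_(m : {ffun 'I_r.+1 -> 'I_N.+1} | chain (fun i => m i))
    (\prod_i dfall lam 1 (m i)) * stirling1 lam N (m ord_max) /
    ((\prod_(i | i != ord_max) (m i).-1`!%:R) *
     (\prod_(i | i != ord_max) (m i)%:R ^ k i) *
     (m ord_max)%:R ^ (k ord_max - 1)).

Lemma chain_stirling_sum0 N : (N <= r)%N -> chain_stirling_sum N = 0.
Proof.
move=> leNr; apply: big_pred0 => m; apply/negP => /chain_last_gt.
by rewrite ltnNge (leq_trans _ leNr) // -ltnS.
Qed.

(** Substitute [L ^+ M = M! \sum_N S_1(N, M) t ^+ N / N!] and collect the
    chains by their last entry [M]; the factor [M!] cancels [(M - 1)!] up to
    [M], which lowers the last exponent by one. *)
Lemma coef_dEi_dlog1p N :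
  (dEi lam k \oF dlog1p lam) N = chain_stirling_sum N / N`!%:R.
Proof.
rewrite /fps_comp /= /chain_stirling_sum mulr_suml.
rewrite (partition_big (fun m : {ffun 'I_r.+1 -> 'I_N.+1} => m ord_max)
  xpredT) //=.
apply: eq_bigr => M _; have leMN : (M <= N)%N by rewrite -ltnS.
rewrite (sum_chain_last (fun m : 'I_r.+1 -> nat =>
  (\prod_i dfall lam 1 (m i)) /
  ((\prod_i (m i).-1`!%:R) * \prod_i (m i)%:R ^ k i)) leMN).
rewrite mulr_suml; apply: eq_bigr => m /andP[cm /eqP mM].
rewrite coef_dlog1pX //.
rewrite [\prod_i (m i).-1`!%:R](bigD1 ord_max) //=.
rewrite [\prod_i (m i)%:R ^ k i](bigD1 ord_max) //= mM.
have M0 : (0 < M)%N by rewrite -mM; apply: (chain_gt0 _ cm).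
have nf j : j`!%:R != 0 :> R by rewrite pnatr_eq0 -lt0n fact_gt0.
have MR0 : M%:R != 0 :> R by rewrite pnatr_eq0 -lt0n.
rewrite expfzDr // exprN1.
have -> : M`!%:R = M%:R * M.-1`!%:R :> R.
  by rewrite -natrM -[in LHS](prednK M0) factS prednK.
have P1 : \prod_(i | i != ord_max) (m i).-1`!%:R != 0 :> R.
  by apply/prodf_neq0 => i _; apply: nf.
have P2 : \prod_(i | i != ord_max) (m i)%:R ^ k i != 0 :> R.
  apply/prodf_neq0 => i _; apply: expfz_neq0.
  by rewrite pnatr_eq0 -lt0n (chain_gt0 i cm).
have P3 : M%:R ^ k ord_max != 0 :> R by apply: expfz_neq0.
by field; rewrite P1 P2 P3 MR0 !nf.
Qed.

(** Binomial convolution of the exponential generating functions of the Euler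
    polynomials and of [Ei o L]. *)
Lemma dmpGenocchi_sum n x :
  dmpGenocchi lam k n x =
  \sum_(l < n.+1)
    'C(n, l)%:R * dEuler lam r.+1 l x * chain_stirling_sum (n - l).
Proof.
rewrite /dmpGenocchi.
set E := dEi lam k \oF dlog1p lam.
have -> : 2%:R ^+ r.+1 * E / (dexp lam 1 + 1) ^+ r.+1 * dexp lam x =
    (2%:R / (dexp lam 1 + 1)) ^+ r.+1 * dexp lam x * E.
  by rewrite exprMn exprVn; ring.
rewrite fcoefM mulr_sumr; apply: eq_bigr => l _.
have leln : (l <= n)%N by rewrite -ltnS.
rewrite /E coef_dEi_dlog1p /dEuler -(bin_fact leln) !natrM.
have nf j : j`!%:R != 0 :> R by rewrite pnatr_eq0 -lt0n fact_gt0.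
by field; rewrite nf.
Qed.

End Genocchi.

Theorem theorem2p1 (R : realType) (lam : R) (r : nat) (k : 'I_r.+1 -> int)
    (x : R) :
  (forall n : nat, (r.+1 <= n)%N ->
     dmpGenocchi lam k n x =
     \sum_(l < (n - r.+1).+1)
       'C(n, l)%:R * dEuler lam r.+1 l x *
       \sum_(m : {ffun 'I_r.+1 -> 'I_(n - l).+1} | chain (fun i => m i))
         (\prod_i dfall lam 1 (m i)) * stirling1 lam (n - l)%N (m ord_max) /
         ((\prod_(i | i != ord_max) (m i).-1`!%:R) *
          (\prod_(i | i != ord_max) (m i)%:R ^ k i) *
          (m ord_max)%:R ^ (k ord_max - 1)))
  /\
  (forall n : nat, (n < r.+1)%N -> dmpGenocchi lam k n x = 0).
Proof.
split=> n len; rewrite dmpGenocchi_sum; last first.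
  apply: big1 => l _; rewrite chain_stirling_sum0 ?mulr0 //.
  by rewrite (leq_trans (leq_subr _ _)).
(* Extend the sum over [l <= n - r.+1] to [l <= n]; the new terms vanish. *)
have le1 : ((n - r.+1).+1 <= n.+1)%N by rewrite ltnS leq_subr.
rewrite [RHS](big_ord_widen _ (fun l => 'C(n, l)%:R * dEuler lam r.+1 l x *
  chain_stirling_sum lam k (n - l)) le1) [RHS]big_mkcond /=.
apply: eq_bigr => l _; case: ltnP => // ltl.
rewrite chain_stirling_sum0 ?mulr0 // leq_subLR addnC -ltnS -addSn.
by rewrite -ltn_subLR.
Qed.
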